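(* Let $b,w$ be positive integers. If $b\neq w$, then $$(2b-1)(2w-1)+(b+w-1)^2\le h_{b\times w}\le \frac{(2bw)^{2bw+1}}{(2bw-1)^{2bw-1}}.$$ If $b=w$, then $$(2b-1)^2\le h_{b\times w}\le \frac{(b^2)^{2b^2+1}}{(b^2-1)^{2b^2-1}},$$ where for $b=w=1$ the right-hand side (which has zero denominator) is interpreted as $+\infty$.
   Context: Let $b,w$ be positive integers. A $b\times w$ block is a subset of $\mathbb{R}^3$ of the form $[x,x+b]\times[y,y+w]\times[z,z+1]$ or $[x,x+w]\times[y,y+b]\times[z,z+1]$ with $x,y,z\in\mathbb{Z}$. A building is a finite set of blocks with pairwise disjoint interiors. Two blocks of a building are attached if their $z$-coordinates differ by exactly $1$ and their projections to the $xy$-plane overlap in a set with nonempty interior (i.e. at least one stud of the lower block is inserted into the upper block). A building is contiguous if the graph on its blocks given by attachment is connected. Two buildings are identified if one is mapped onto the other by a composition of translations of $\mathbb{R}^3$ and rotations about vertical axes (rotations in the $xy$-plane, by multiples of $90^\circ$). $T_{b\times w}(n)$ denotes the number of contiguous buildings consisting of exactly $n$ blocks of dimension $b\times w$, counted up to this identification. The entropy is $s_{b\times w}=\lim_{n\to\infty}\frac{\log(T_{b\times w}(n))}{n}$ (this limit exists and is finite), and $h_{b\times w}=\exp(s_{b\times w})$. *)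

(* Defs.v *)
From HB Require Import structures.
From Stdlib Require Import Relation_Operators.
From mathcomp Require Import all_boot all_order all_algebra finmap.
From mathcomp Require Import all_classical all_reals all_analysis.

Set Implicit Arguments.
Unset Strict Implicit.
Unset Printing Implicit Defensive.

Import Order.TTheory GRing.Theory Num.Theory.
Import numFieldNormedType.Exports.

Local Open Scope classical_set_scope.
Local Open Scope ring_scope.

Section Lego.
Variable R : realType.

Notation R3 := (R * R * R)%type.

Definition box (x y z : int) (p q : nat) : set R3 :=
  `[x%:~R, x%:~R + p%:R] `*` `[y%:~R, y%:~R + q%:R] `*` `[z%:~R, z%:~R + 1].

Section Blocks.
Variables b w : nat.

Definition block_at (z : int) (A : set R3) : Prop :=
  exists x y : int, A = box x y z b w \/ A = box x y z w b.

Definition block (A : set R3) : Prop := exists z : int, block_at z A.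

Definition building (B : set (set R3)) : Prop :=
  [/\ finite_set B, B `<=` block & trivIset B (fun A => A°)].

Definition levels_adjacent (A A' : set R3) : Prop :=
  exists z : int,
    (block_at z A /\ block_at (z + 1) A') \/
    (block_at z A' /\ block_at (z + 1) A).

Definition xy_projection (A : set R3) : set (R * R) := [set u.1 | u in A].

Definition attached (A A' : set R3) : Prop :=
  levels_adjacent A A' /\
  (xy_projection A `&` xy_projection A')° !=set0.

Definition contiguous (B : set (set R3)) : Prop :=
  forall A A', B A -> B A' ->
    clos_refl_trans _ (fun C C' => [/\ B C, B C' & attached C C']) A A'.

End Blocks.

Definition translation (t : R3) : R3 -> R3 := fun u => u + t.

(* Counterclockwise rotation by 90 degrees about the vertical axis through
   [(c.1, c.2, 0)]. *)
Definition quarter_turn (c : R * R) : R3 -> R3 :=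
  fun u => (c.1 - (u.1.2 - c.2), c.2 + (u.1.1 - c.1), u.2).

Inductive motion : (R3 -> R3) -> Prop :=
| motion_translation t : motion (translation t)
| motion_rotation c k : motion (iter k (quarter_turn c))
| motion_comp f g : motion f -> motion g -> motion (f \o g).

Definition identified (B B' : set (set R3)) : Prop :=
  exists2 f, motion f & [set f @` A | A in B] = B'.

Variables b w : nat.

Definition contiguous_buildings (n : nat) : set (set (set R3)) :=
  [set B | [/\ building b w B, contiguous b w B & (B #= `I_n)%card]].

Definition building_classes (n : nat) : set (set (set (set R3))) :=
  [set [set B' | contiguous_buildings n B' /\ identified B B']
     | B in contiguous_buildings n].

(* [fset_set] is meaningful here because [building_classes n] is finite. *)
Definition building_count (n : nat) : nat := #|` fset_set (building_classes n)|.

Definition entropy : R := limn (fun n => ln (building_count n)%:R / n%:R : R).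

Definition exp_entropy : R := expR entropy.

End Lego.

(* Main.v *)
(* Normalize buildings up to translation so that the lexicographically least block
   sits at the origin, and let t(n) count the normalized ones.  Only four
   rotations are available, so T(n) <= t(n) <= 4 T(n).

   Putting one building on top of another can be undone: the lower one consists
   of the blocks up to some level, which its number of blocks determines.  Hence
   t(m + n) >= t(m) t(n), the entropy exists by Fekete's lemma, and adding a
   single block on top in all possible ways gives t(n + 1) >= K t(n) for the
   number K of ways of attaching a block to the top of a given one.

   For the upper bound, explore a building from a root block, going through a
   queue of cells: the next cell is left free or is filled by one of the L blocks
   covering it, whose k = 2bw neighbouring cells then join the queue.  The number
   G(q, m) of outcomes with q cells queued and m blocks to place satisfies
   G(q + 1, m + 1) <= G(q, m + 1) + L G(q + k, m), so it is at most a^q h^m whenever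
   a > 1 and L a^k <= (a - 1) h.  The choices a = x / (x - 1) and h = x^(k+1) / (x - 1)^(k-1),
   with x = L, give the bounds of the theorem. *)
Require Import Defs.
From HB Require Import structures.
From Stdlib Require Import Relation_Operators.
From mathcomp Require Import all_boot all_order all_algebra finmap.
From mathcomp Require Import all_classical all_reals all_analysis.
From mathcomp Require Import zify ring lra.

Set Implicit Arguments.
Unset Strict Implicit.
Unset Printing Implicit Defensive.

Import Order.TTheory GRing.Theory Num.Theory.
Import numFieldNormedType.Exports.

Local Open Scope ring_scope.

(** * Growth rates of supermultiplicative sequences *)

Section Growth.
Local Open Scope classical_set_scope.
Variable R : realType.
Implicit Types (u : nat -> R) (t T : nat -> nat).

Lemma superadditive_mul u m q r :
  (forall i j, (0 < i)%N -> (0 < j)%N -> u i + u j <= u (i + j)%N) ->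
  (forall i, 0 <= u i) -> (0 < m)%N -> q%:R * u m <= u (q * m + r)%N.
Proof.
move=> uD u0 m0; elim: q => [|q IHq]; first by rewrite mul0r.
rewrite mulSn -addnA -natr1 mulrDl mul1r addrC.
(* Superadditivity applies to positive arguments only; [q * m + r = 0] forces [q = 0], and both
   sides are then [u m]. *)
case: (posnP (q * m + r)) => [qr0|qr0]; last first.
  by apply: le_trans (uD _ _ m0 qr0); rewrite lerD2l.
have q0 : q = 0%N by move: qr0 m0; case: q {IHq} => // q; rewrite mulSn; case: m.
by rewrite qr0 q0 mul0r addr0 addn0.
Qed.

(** Fekete's lemma: the limit is the supremum of the quotients. If [m] nearly attains it, division
    of a large [n] by [m] shows that [n] nearly attains it too. *)
Lemma superadditive_cvg u (C : R) :
  (forall m n, (0 < m)%N -> (0 < n)%N -> u m + u n <= u (m + n)%N) ->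
  (forall n, 0 <= u n) -> (forall n, u n <= C * n%:R) ->
  cvgn (fun n => u n / n%:R).
Proof.
move=> uD u0 uC.
pose E := [set u n / n%:R | n in [set n | (0 < n)%N]].
have En0 : E !=set0 by exists (u 1%N / 1%:R); exists 1%N.
have Eub : has_ubound E.
  exists C => _ [n /= n0 <-].
  by rewrite ler_pdivrMr ?ltr0n.
have Esup : has_sup E by [].
suff : (fun n => u n / n%:R) @ \oo --> sup E by move=> /cvgP.
apply/cvgrPdist_le => e e0.
have [_ [m /= m0 <-] me] := sup_adherent (divr_gt0 e0 (ltr0n R 2)) Esup.
have m0R : 0 < m%:R :> R by rewrite ltr0n.
near=> n.
have n0 : (0 < n)%N by near: n; exists 1%N.
have n0R : 0 < n%:R :> R by rewrite ltr0n.
have nE : u n / n%:R <= sup E by apply: ub_le_sup => //; exists n.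
rewrite ger0_norm ?subr_ge0//.
have := @superadditive_mul u m (n %/ m) (n %% m) uD u0 m0.
rewrite -divn_eq => qn.
have nqm : (n%:R - m%:R : R) <= (n %/ m)%:R * m%:R.
  rewrite lerBlDr -natrM -natrD ler_nat {1}(divn_eq n m) leq_add2l.
  by rewrite ltnW// ltn_mod.
have H : u m / m%:R * (n%:R - m%:R) <= u n.
  apply: le_trans qn; apply: le_trans (_ : u m / m%:R * ((n %/ m)%:R * m%:R) <= _).
    by rewrite ler_wpM2l// divr_ge0.
  by rewrite [leRHS]mulrC (mulrC _ m%:R) mulrA mulfVK// gt_eqF.
(* Dropping the remainder of [n] modulo [m] costs at most [u m / n], which this threshold keeps
   below [e / 2]. *)
have nu : u m * 2 / e <= n%:R by near: n; exact: nbhs_infty_ger.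
have H2 : u m / m%:R - e / 2 <= u n / n%:R.
  rewrite ler_pdivlMr// mulrBl; apply: le_trans H.
  rewrite mulrBr lerD2l lerN2 mulfVK ?gt_eqF//.
  move: nu; rewrite ler_pdivrMr// => nu.
  lra.
lra.
Unshelve. all: end_near. Qed.

Lemma cvg_natrV : (fun n : nat => n%:R^-1 : R) @ \oo --> (0 : R).
Proof.
apply/cvgrPdist_le => e e0; near=> n.
rewrite sub0r normrN ger0_norm ?invr_ge0//.
have n0 : 0 < n%:R :> R by rewrite ltr0n; near: n; exists 1%N.
rewrite -(invrK e) lef_pV2 ?posrE ?invr_gt0//.
by near: n; exact: nbhs_infty_ger.
Unshelve. all: end_near. Qed.

Lemma limn_div_ge u (x C : R) : cvgn (fun n => u n / n%:R) ->
  (forall n, x * n%:R - C <= u n.+1) -> x <= limn (fun n => u n / n%:R).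
Proof.
move=> cu ux; rewrite -(subr0 x).
(* At index [n] the hypothesis reads [x * (n - 1) - C <= u n]; the absolute values absorb both the
   shift and the constant. *)
have hC : (fun n => x - (`|x| + `|C|) / n%:R : R) @ \oo --> x - 0.
  apply: cvgB; first exact: cvg_cst.
  rewrite -[X in _ --> X](mulr0 (`|x| + `|C|)); apply: cvgM; first exact: cvg_cst.
  exact: cvg_natrV.
rewrite -(cvg_lim _ hC)//; apply: ler_lim => //; first by apply: cvgP hC.
near=> n.
have n0 : (0 < n)%N by near: n; exists 1%N.
have n0R : 0 < n%:R :> R by rewrite ltr0n.
rewrite ler_pdivlMr// mulrBl mulfVK ?gt_eqF//.
have := ux n.-1; rewrite prednK// => /(le_trans _); apply.
rewrite -{1}(prednK n0) -natr1.
have := ler_norm x; have := ler_norm C; nra.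
Unshelve. all: end_near. Qed.

Lemma limn_div_le u (x C : R) : cvgn (fun n => u n / n%:R) ->
  (forall n, u n.+1 <= x * n%:R + C) -> limn (fun n => u n / n%:R) <= x.
Proof.
move=> cu ux; rewrite -lerN2.
have E : (fun n => - u n / n%:R) = - (fun n => u n / n%:R).
  by apply/funext => n; rewrite mulNr.
rewrite -limN// -E; apply: (@limn_div_ge _ _ C); first by rewrite E; exact: is_cvgN.
by move=> n; rewrite mulNr -opprD lerN2.
Qed.

(** The logarithm of [t] is superadditive and at most linear, so its growth rate exists. [T] has the
    same rate, since the factor [M] contributes only [ln M / n]. *)
Lemma growth_rate_bounds t T (k K c C : R) (M : nat) :
  (forall m n, (0 < m)%N -> (0 < n)%N -> (t m * t n <= t (m + n))%N) ->
  (forall n, (0 < n)%N -> (T n <= t n <= M * T n)%N) ->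
  0 < K -> 0 < k -> 0 < c -> 0 < C ->
  (forall n, k * K ^+ n <= (t n.+1)%:R) ->
  (forall n, (t n.+1)%:R <= C * c ^+ n) ->
  K <= expR (limn (fun n => ln (T n)%:R / n%:R)) <= c.
Proof.
move=> tM tT K0 k0 c0 C0 tK tC.
have t0 n : (0 < n)%N -> (0 < t n)%N.
  case: n => // n _; rewrite -(ltr0n R); apply: lt_le_trans (tK n).
  by rewrite mulr_gt0// exprn_gt0.
have T0 n : (0 < n)%N -> (0 < T n)%N.
  move=> n0; have /andP[_] := tT _ n0.
  by case: (T n) => //; rewrite muln0 leqNgt t0.
have M0 : (0 < M)%N.
  have /andP[_] := tT 1%N isT; have := t0 1%N isT.
  by case: M {tT} => //; case: (t 1%N).
(* The value 0 at index 0 makes the linear bound hold there whatever [t 0] is. *)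
pose u n : R := if n is 0%N then 0 else ln (t n)%:R.
have uE n : (0 < n)%N -> u n = ln (t n)%:R by case: n.
have lnC n : ln ((t n.+1)%:R : R) <= ln c * n%:R + ln C.
  rewrite -ler_expR lnK ?posrE ?ltr0n ?t0//.
  apply: le_trans (tC n) _.
  by rewrite addrC expRD lnK ?posrE// expRM_natr lnK ?posrE.
have u0 n : 0 <= u n by case: n => // n; rewrite /u ln_ge0// ler1n t0.
have uc : cvgn (fun n => u n / n%:R).
  apply: (@superadditive_cvg _ (`|ln c| + `|ln C|)) => //.
    move=> m n m0 n0; rewrite !uE ?addn_gt0 ?m0// -lnM ?posrE ?ltr0n ?t0//.
    by rewrite ler_ln ?posrE ?mulr_gt0 ?ltr0n ?t0 ?addn_gt0 ?m0// -natrM ler_nat tM.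
  case=> [|n]; first by rewrite mulr0.
  rewrite /u; apply: le_trans (lnC n) _.
  rewrite mulrDl lerD//.
    by rewrite -natr1 mulrDr mulr1 ler_wpDr// ler_wpM2r// ler_norm.
  by apply: le_trans (ler_norm _) _; rewrite ler_peMr// ler1n.
have Tc : (fun n => ln (T n)%:R / n%:R : R) @ \oo --> limn (fun n => u n / n%:R).
  have lo : (fun n => u n / n%:R - ln M%:R * n%:R^-1) @ \oo -->
     limn (fun n => u n / n%:R) - ln M%:R * 0.
    apply: cvgB => //; apply: cvgM; first exact: cvg_cst.
    exact: cvg_natrV.
  rewrite mulr0 subr0 in lo.
  apply: (squeeze_cvgr _ lo uc); near=> n.
  have n0 : (0 < n)%N by near: n; exists 1%N.
  have /andP[Tt tTM] := tT n n0.
  rewrite -mulrBl !ler_pM2r ?invr_gt0 ?ltr0n// uE//.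
  rewrite -ln_div ?posrE ?ltr0n ?t0 ?T0//.
  rewrite !ler_ln ?posrE ?ltr0n ?divr_gt0 ?ltr0n ?t0 ?T0// ler_nat Tt andbT.
  by rewrite ler_pdivrMr ?ltr0n// -natrM ler_nat mulnC.
rewrite (cvg_lim _ Tc)//; apply/andP; split.
  rewrite -[leLHS]lnK ?posrE// ler_expR; apply: (@limn_div_ge _ _ (- ln k)) => // n.
  rewrite opprK /u -ler_expR [leRHS]lnK ?posrE ?ltr0n ?t0//.
  by apply: le_trans (tK n); rewrite addrC expRD lnK ?posrE// expRM_natr lnK ?posrE.
rewrite -[leRHS]lnK ?posrE// ler_expR; apply: (@limn_div_le _ _ (ln C)) => //.
Unshelve. all: end_near. Qed.

End Growth.

(** * Assemblies of blocks given by integer coordinates *)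

Lemma clos_rt_homo (T T' : Type) (r : T -> T -> Prop) (r' : T' -> T' -> Prop)
    (f : T -> T') :
  (forall x y, r x y -> r' (f x) (f y)) ->
  forall x y, clos_refl_trans _ r x y -> clos_refl_trans _ r' (f x) (f y).
Proof.
move=> rr' x y; elim=> {x y} [x y /rr'| x | x y z _ xy _ yz].
- exact: rt_step.
- exact: rt_refl.
- exact: rt_trans xy yz.
Qed.

Lemma clos_rt_sub (T : Type) (r r' : T -> T -> Prop) :
  (forall x y, r x y -> r' x y) ->
  forall x y, clos_refl_trans _ r x y -> clos_refl_trans _ r' x y.
Proof. exact: (@clos_rt_homo _ _ _ _ id). Qed.

Lemma clos_rt_closed (T : Type) (r : T -> T -> Prop) (P : T -> Prop) :
  (forall x y, r x y -> P x -> P y) ->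
  forall x y, clos_refl_trans _ r x y -> P x -> P y.
Proof.
move=> rP x y; elim=> {x y} [x y /rP//| // | x y z _ xy _ yz /xy]; exact: yz.
Qed.

(** Stated for a preorder, because blocks are compared below by level or by position alone. *)
Lemma exists_least (T : choiceType) (r : rel T) (C : {fset T}) c0 :
  total r -> transitive r -> c0 \in C ->
  exists2 c, c \in C & {in C, forall d, r c d}.
Proof.
move=> rtot rtr; elim/finSet_rect: C c0 => C IHC c0 c0C.
have rr c : r c c by have := rtot c c; rewrite orbb.
have [C0|[c1 c1C]] := fset_0Vmem (C `\ c0)%fset.
  exists c0 => // d dC; case: (eqVneq d c0) => [->//|dc0].
  have : d \in (C `\ c0)%fset by rewrite !inE dc0.
  by rewrite C0.
have [c cC cmin] := IHC (C `\ c0)%fset (fproperD1 c0C) c1 c1C.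
have [cc0|c0c] := orP (rtot c c0).
  exists c; first by move: cC; rewrite !inE => /andP[].
  move=> d dC; case: (eqVneq d c0) => [->//|dc0].
  by apply: cmin; rewrite !inE dc0.
exists c0 => // d dC; case: (eqVneq d c0) => [->//|dc0].
by apply: rtr c0c _; apply: cmin; rewrite !inE dc0.
Qed.

Section Combinatorics.
Local Open Scope fset_scope.
Local Open Scope ring_scope.
Variables b w : nat.

(** A block is encoded by its corner with least coordinates and its orientation, [true] meaning that
    the side [w] runs along the x axis. *)
Notation pos := (int * int * int)%type.
Notation blk := (pos * bool)%type.

Implicit Types (A B C D S : {fset blk}) (c d : blk) (u v p : pos) (o : bool).

Definition xdim (o : bool) := if o then w else b.
Definition ydim (o : bool) := if o then b else w.

(* For [b = w] the two orientations give the same block. *)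
Definition orientations := if b == w then [:: false] else [:: false; true].

(** For positive lengths, this says that the open intervals [(x, x + p)] and [(x', x' + p')]
    meet. *)
Definition overlap (x : int) (p : nat) (x' : int) (p' : nat) : bool :=
  (x < x' + p'%:Z) && (x' < x + p%:Z).

Definition xyoverlap (c d : blk) : bool :=
  overlap c.1.1.1 (xdim c.2) d.1.1.1 (xdim d.2) &&
  overlap c.1.1.2 (ydim c.2) d.1.1.2 (ydim d.2).

Definition level (c : blk) : int := c.1.2.

Definition clash (c d : blk) : bool := (level c == level d) && xyoverlap c d.

Definition stacked (c d : blk) : bool :=
  ((level d == level c + 1) || (level c == level d + 1)) && xyoverlap c d.

Definition stacked_in (C : {fset blk}) (c d : blk) : Prop :=
  [/\ c \in C, d \in C & stacked c d].

(** Disjointness is phrased as equality of clashing blocks because, for positive [b] and [w], a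
    block clashes with itself. *)
Definition assembly (C : {fset blk}) : Prop :=
  [/\ {in C, forall c, c.2 \in orientations},
      {in C &, forall c d, clash c d -> c = d} &
      {in C &, forall c d, clos_refl_trans _ (stacked_in C) c d}].

Definition move_block (v : pos) (c : blk) : blk :=
  ((c.1.1.1 + v.1.1, c.1.1.2 + v.1.2, c.1.2 + v.2), c.2).

Definition move_blocks (v : pos) (C : {fset blk}) : {fset blk} :=
  [fset move_block v c | c in C].

(* The nonnegative positions for the lexicographic order on [(z, x, y)]. *)
Definition nonneg_pos (v : pos) : bool :=
  (0 < v.2) ||
  (v.2 == 0) && ((0 < v.1.1) || (v.1.1 == 0) && (0 <= v.1.2)).

Definition origin : pos := (0, 0, 0).

Definition normal (C : {fset blk}) : Prop :=
  (exists o, (origin, o) \in C) /\ {in C, forall c, nonneg_pos c.1}.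

Definition normal_assembly (n : nat) (C : {fset blk}) : Prop :=
  [/\ assembly C, normal C & #|` C| = n].

Definition opp_pos (v : pos) : pos := (- v.1.1, - v.1.2, - v.2).

Lemma move_blockK v : cancel (move_block v) (move_block (opp_pos v)).
Proof. by move=> [[[x y] z] o]; rewrite /move_block/= !addrK. Qed.

Lemma move_block_inj v : injective (move_block v).
Proof. exact: can_inj (move_blockK v). Qed.

Lemma mem_move_blocks v C c : (move_block v c \in move_blocks v C) = (c \in C).
Proof.
apply/imfsetP/idP => [[d /= dC /move_block_inj ->//]|cC]; by exists c.
Qed.

Lemma move_blocksP v C c : reflect (exists2 d, d \in C & c = move_block v d) (c \in move_blocks v C).
Proof. by apply: (iffP (imfsetP _ _ _ _)) => -[d dC ->]; exists d. Qed.

Lemma card_move_blocks v C : #|` move_blocks v C| = #|` C|.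
Proof. by rewrite card_imfset//; exact: move_block_inj. Qed.

Lemma xyoverlap_move_block v c d : xyoverlap (move_block v c) (move_block v d) = xyoverlap c d.
Proof.
move: v c d => [[vx vy] vz] [[[x y] z] o] [[[x' y'] z'] o'].
rewrite /xyoverlap /overlap /=; lia.
Qed.

Lemma clash_move_block v c d : clash (move_block v c) (move_block v d) = clash c d.
Proof. by rewrite /clash xyoverlap_move_block /level /= (inj_eq (addIr _)). Qed.

Lemma stacked_move_block v c d : stacked (move_block v c) (move_block v d) = stacked c d.
Proof.
by rewrite /stacked xyoverlap_move_block /level /= ![_ + v.2 + 1]addrAC !(inj_eq (addIr _)).
Qed.

Lemma stackedC c d : stacked c d = stacked d c.
Proof.
move: c d => [[[x y] z] o] [[[x' y'] z'] o'].
by rewrite /stacked /xyoverlap /overlap /level /= orbC; congr (_ && _); lia.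
Qed.

Lemma assembly_move_blocks v C : assembly C -> assembly (move_blocks v C).
Proof.
move=> [Co Cd Cc]; split.
- by move=> _ /move_blocksP[c cC ->]; exact: (Co _ cC).
- move=> _ _ /move_blocksP[c cC ->] /move_blocksP[d dC ->]; rewrite clash_move_block => cd.
  by rewrite (Cd _ _ cC dC cd).
- move=> _ _ /move_blocksP[c cC ->] /move_blocksP[d dC ->].
  apply: (clos_rt_homo _ (Cc _ _ cC dC)) => x y [xC yC xy].
  by split; rewrite ?mem_move_blocks ?stacked_move_block.
Qed.

(** Either shift sends a lexicographically least position of [C] to the origin, and that position is
    unique. *)
Lemma normal_move_blocks_uniq v v' C :
  normal (move_blocks v C) -> normal (move_blocks v' C) -> v = v'.
Proof.
move: v v' => [[x y] z] [[x' y'] z'].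
move=> [[ o /move_blocksP[[[[cx cy] cz] co] cC [ex ey ez eo]]] nC].
move=> [[ o' /move_blocksP[[[[dx dy] dz] do'] dC [ex' ey' ez' eo']]] nC'].
have := nC _ (etrans (mem_move_blocks _ _ _) dC).
have := nC' _ (etrans (mem_move_blocks _ _ _) cC).
by rewrite /nonneg_pos /=; simpl in *; move=> ? ?; congr (_, _, _); lia.
Qed.

Lemma move_blocksK v : cancel (move_blocks v) (move_blocks (opp_pos v)).
Proof.
move=> C; apply/fsetP => c; apply/move_blocksP/idP => [[_ /move_blocksP[d dC ->] ->]|cC].
  by rewrite move_blockK.
by exists (move_block v c); rewrite ?mem_move_blocks ?move_blockK.
Qed.

Lemma move_blocks_inj v : injective (move_blocks v).
Proof. exact: can_inj (move_blocksK v). Qed.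

(** Undoing each of the two shifts on the common assembly gives a normal one, so the shifts agree by
    uniqueness. *)
Lemma normal_eq_move_blocks v v' C D : normal C -> normal D ->
  move_blocks v C = move_blocks v' D -> v = v' /\ C = D.
Proof.
move=> nC nD CD.
suff vv' : v = v' by split=> //; move: CD; rewrite vv' => /move_blocks_inj.
have : opp_pos v = opp_pos v'.
  apply: (@normal_move_blocks_uniq _ _ (move_blocks v C)); first by rewrite move_blocksK.
  by rewrite CD move_blocksK.
by case: v v' {CD} => [[? ?] ?] [[? ?] ?] [/oppr_inj-> /oppr_inj-> /oppr_inj->].
Qed.

Lemma exists_max_level C c0 : c0 \in C ->
  exists2 c, c \in C & {in C, forall d, level d <= level c}.
Proof.
apply: (@exists_least _ (fun c d => level d <= level c)) => [c d|c d e dc ce].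
  exact: le_total.
exact: le_trans ce dc.
Qed.

Lemma exists_min_pos C c0 : c0 \in C ->
  exists2 c, c \in C & {in C, forall d, nonneg_pos (move_block (opp_pos c.1) d).1}.
Proof.
apply: (@exists_least _ (fun c d => nonneg_pos (move_block (opp_pos c.1) d).1)).
  by move=> c d; rewrite /nonneg_pos /=; lia.
by move=> c d e; rewrite /nonneg_pos /=; lia.
Qed.

Lemma exists_normal_move_blocks (C : {fset blk}) : (0 < #|` C|)%N ->
  exists v, normal (move_blocks v C).
Proof.
rewrite cardfs_gt0 => /fset0Pn[c0 /exists_min_pos[[p o] cC cmin]].
exists (opp_pos p); split.
  exists o; apply/move_blocksP; exists (p, o) => //.
  by rewrite /move_block /= !subrr.
by move=> _ /move_blocksP[d dC ->]; exact: cmin.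
Qed.

(** * Exploring an assembly *)

(** Here a position [u] stands for the unit cell of which it is the least corner; hence the
    half-open bounds. *)
Definition covers (c : blk) (u : pos) : bool :=
  [&& c.1.1.1 <= u.1.1, u.1.1 < c.1.1.1 + (xdim c.2)%:Z,
      c.1.1.2 <= u.1.2, u.1.2 < c.1.1.2 + (ydim c.2)%:Z & u.2 == c.1.2].

Definition coverings (u : pos) : seq blk :=
  [seq ((u.1.1 - e.1%:Z, u.1.2 - e.2%:Z, u.2), o)
    | o <- orientations, e <- [seq (i, j) | i <- iota 0 (xdim o), j <- iota 0 (ydim o)]].

Definition studs_at (c : blk) (z : int) : seq pos :=
  [seq (c.1.1.1 + i%:Z, c.1.1.2 + j%:Z, z)
    | i <- iota 0 (xdim c.2), j <- iota 0 (ydim c.2)].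

(** The cells below the block are included along with those above it, since an attached block may
    lie on either side. *)
Definition studs (c : blk) : seq pos :=
  studs_at c (level c + 1) ++ studs_at c (level c - 1).

Hypotheses (b_gt0 : (0 < b)%N) (w_gt0 : (0 < w)%N).

Lemma xdim_gt0 o : (0 < xdim o)%N. Proof. by case: o. Qed.

Lemma ydim_gt0 o : (0 < ydim o)%N. Proof. by case: o. Qed.

Lemma dimM o : (xdim o * ydim o = b * w)%N.
Proof. by case: o => //=; rewrite mulnC. Qed.

Lemma size_coverings u : size (coverings u) = (size orientations * (b * w))%N.
Proof.
rewrite size_allpairs_dep /orientations; case: ifP => _ /=;
by rewrite !size_allpairs !size_iota; lia.
Qed.

Lemma size_studs c : size (studs c) = (2 * (b * w))%N.
Proof. by rewrite size_cat !size_allpairs !size_iota dimM mul2n addnn. Qed.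

Lemma mem_coverings c u : c.2 \in orientations -> covers c u -> c \in coverings u.
Proof.
move: c u => [[[x y] z] o] [[ux uy] uz] /= oo /and5P[/= x1 x2 y1 y2 /eqP uzz].
apply/allpairsPdep => /=; exists o, (`|ux - x|%N, `|uy - y|%N); split => //.
  by apply/allpairsP; exists (`|ux - x|%N, `|uy - y|%N); rewrite !mem_iota /=; split=> //; lia.
by congr (_, _, _, _) => /=; lia.
Qed.

Lemma covers_clash c d u : covers c u -> covers d u -> clash c d.
Proof.
move: c d u => [[[x y] z] o] [[[x' y'] z'] o'] [[ux uy] uz].
rewrite /covers /clash /xyoverlap /overlap /level /=; lia.
Qed.

Lemma stacked_studs c d : stacked c d -> exists2 u, u \in studs c & covers d u.
Proof.
move: c d => [[[x y] z] o] [[[x' y'] z'] o'].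
rewrite /stacked /xyoverlap /overlap /level /= => H.
have := (xdim_gt0 o, xdim_gt0 o', ydim_gt0 o, ydim_gt0 o') => -[[[? ?] ?] ?].
(* The least corner of the common rectangle of the two projections, at the level of [d]. *)
exists (Num.max x x', Num.max y y', z'); last by rewrite /covers /=; lia.
rewrite mem_cat; apply/orP.
have S z0 : z' = z0 -> (Num.max x x', Num.max y y', z') \in studs_at (x, y, z, o) z0.
  move=> <-; apply/allpairsP; exists (`|Num.max x x' - x|%N, `|Num.max y y' - y|%N).
  by rewrite !mem_iota /=; split; [lia|lia|congr (_, _, _); lia].
case/andP: H => /orP[/eqP z'E|/eqP zE] _; [left|right]; apply: S; rewrite /level/=; lia.
Qed.

(* Each stud [u] of the queue is either left free or occupied by one of the
   blocks covering it; [m] blocks remain to be added to [S]. *)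
Fixpoint explore (m : nat) : {fset blk} -> seq pos -> seq {fset blk} :=
  fix explore_queue S Q :=
    match Q with
    | [::] => if m is 0%N then [:: S] else [::]
    | u :: Q' =>
        explore_queue S Q' ++
        (if m is m'.+1 then
           flatten [seq explore m' (c |` S) (Q' ++ studs c) | c <- coverings u]
         else [::])
    end.

(** Each queued cell has weight [a] and each block still to be placed weight [q]. With L coverings
    per cell and k studs per block, the induction reduces to [q + L * a ^+ k <= a * q], which is the
    hypothesis. *)
Lemma size_explore (R : realType) (a q : R) m S Q :
  1 <= a -> 0 < q ->
  (size orientations * (b * w))%:R * a ^+ (2 * (b * w)) <= (a - 1) * q ->
  (size (explore m S Q))%:R <= a ^+ size Q * q ^+ m.
Proof.
move=> a1 q0 aq; have a0 : 0 < a by apply: lt_le_trans a1.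
elim: m S Q => [|m IHm] S Q; elim: Q S => [|u Q IHQ] S.
- by rewrite /= mulr1.
- rewrite /= cats0; apply: le_trans (IHQ S) _; rewrite !mulr1 exprS.
  by rewrite ler_peMl// exprn_ge0// ltW.
- by rewrite /= mulr_ge0 ?exprn_ge0 ?ltW.
rewrite /= -/(explore m.+1) size_cat natrD.
have H : (size (flatten [seq explore m (c |` S) (Q ++ studs c) | c <- coverings u]))%:R
    <= (size orientations * (b * w))%:R * (a ^+ (size Q + 2 * (b * w)) * q ^+ m).
  rewrite -(size_coverings u); elim: (coverings u) => [|c s IHs]; first by rewrite mul0r.
  rewrite /= size_cat natrD -natr1 mulrDl mul1r addrC lerD//.
  by apply: le_trans (IHm _ _) _; rewrite size_cat size_studs.
apply: le_trans (lerD (IHQ S) H) _.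
set L := _%:R in aq *; set k := (2 * _)%N in aq *.
rewrite exprD [in leRHS]exprS [q ^+ m.+1]exprS.
have -> : a ^+ size Q * (q * q ^+ m) + L * (a ^+ size Q * a ^+ k * q ^+ m)
   = (a ^+ size Q * q ^+ m) * (q + L * a ^+ k) by ring.
have -> : a * a ^+ size Q * (q * q ^+ m) = (a ^+ size Q * q ^+ m) * (a * q) by ring.
apply: ler_wpM2l; first by rewrite mulr_ge0// exprn_ge0// ltW.
by move: aq; rewrite mulrBl mul1r -lerBrDl.
Qed.

(** [S] is the part of [B] found so far. The invariant says that each cell next to [S] is still
    queued or is settled, any block of [B] covering it being already in [S]. *)
Lemma mem_explore (B S : {fset blk}) m Q : assembly B -> (0 < #|` S|)%N ->
  S `<=` B -> #|` B| = (#|` S| + m)%N ->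
  (forall c u, c \in S -> u \in studs c ->
     u \in Q \/ {in B, forall d, covers d u -> d \in S}) ->
  B \in explore m S Q.
Proof.
move=> [Bo Bd Bc]; elim: m S Q => [|m IHm] S Q; elim: Q => [|v Q IHQ] S0 SB cardB QS.
- by rewrite /= inE eq_sym eqEfcard SB cardB addn0 leqnn.
(* No block is left to add, so [S = B], all cells are settled and the queue is merely emptied. *)
- rewrite /= cats0 -/(explore 0); apply: IHQ => // c u cS /(QS _ _ cS) [|]; last by right.
  right => d dB _; move: cardB; rewrite addn0 => cardB.
  suff -> : S = B by [].
  by apply/eqP; rewrite eqEfcard SB cardB leqnn.
(* With an empty queue all cells next to [S] are settled, so [S] is closed under attachment in [B].
   Connectivity gives all of [B], against the count of missing blocks. *)
- suff BS : B `<=` S by have := fsubset_leq_card BS; lia.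
  move: S0; rewrite cardfs_gt0 => /fset0Pn[c cS].
  apply/fsubsetP => d dB; have cB := fsubsetP SB _ cS.
  apply: (@clos_rt_closed _ _ (fun x => x \in S) _ _ _ (Bc _ _ cB dB) cS).
  move=> x y [xB yB xy] xS.
  have [u ux yu] := stacked_studs xy.
  by have [//|H] := QS _ _ xS ux; exact: H.
- rewrite /= -/(explore m.+1) mem_cat.
  (* If some new block of [B] covers [v], its branch is taken, and disjointness makes it the only
     block of [B] there, which settles [v]. Otherwise leaving [v] free settles it. *)
  have [/hasP[d dB /andP[dv dS]]|] := boolP (has (fun d => covers d v && (d \notin S)) B).
    apply/orP; right; apply/flattenP; exists (explore m (d |` S) (Q ++ studs d)).
      by apply/mapP; exists d => //; apply: mem_coverings => //; exact: Bo.
    have SdB : d |` S `<=` B.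
      by apply/fsubsetP => x /fset1UP[->//|]; exact: (fsubsetP SB).
    apply: IHm => //.
    + by rewrite cardfsU1 dS.
    + by rewrite cardfsU1 dS cardB; lia.
    + move=> c u /fset1UP[->|cS] ucs; first by left; rewrite mem_cat ucs orbT.
      have [|H] := QS _ _ cS ucs; last by right => x xB xu; rewrite !inE (H x) ?orbT.
      rewrite inE => /orP[/eqP ->|uQ]; last by left; rewrite mem_cat uQ.
      right => x xB xv; rewrite !inE; apply/orP; left; apply/eqP.
      by apply: Bd => //; exact: covers_clash xv dv.
  move=> /hasPn noB; apply/orP; left; apply: IHQ => // c u cS ucs.
  have [|H] := QS _ _ cS ucs; last by right.
  rewrite inE => /orP[/eqP ->|uQ]; last by left.
  by right => x xB xv; have := noB _ xB; rewrite xv /= negbK.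
Qed.

(** The root at the origin is one of the [n] blocks, whence [n.-1]. *)
Definition normal_assemblies_seq (n : nat) : seq {fset blk} :=
  flatten [seq explore n.-1 [fset (origin, o)] (studs (origin, o)) | o <- orientations].

Lemma mem_normal_assemblies_seq n C : normal_assembly n C -> C \in normal_assemblies_seq n.
Proof.
move=> [cC [[ o oC] _] Cn]; apply/flattenP.
exists (explore n.-1 [fset (origin, o)] (studs (origin, o))).
  by apply/mapP; exists o => //; case: cC => /(_ _ oC).
have oSC : [fset (origin, o)] `<=` C by rewrite fsub1set.
have n0 : (0 < n)%N by rewrite -Cn cardfs_gt0; apply/fset0Pn; exists (origin, o).
apply: mem_explore => //; rewrite ?cardfs1//; first by rewrite Cn; lia.
by move=> c u /fset1P -> ?; left.
Qed.

Lemma finite_normal_assemblies n : finite_set [set C | normal_assembly n C]%classic.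
Proof.
apply: (@sub_finite_set _ _ [set` normal_assemblies_seq n]%classic).
  by move=> C /= /mem_normal_assemblies_seq.
exact: finite_seq.
Qed.

Definition normal_assemblies n : {fset {fset blk}} :=
  fset_set [set C | normal_assembly n C]%classic.

Lemma normal_assembliesP n C : reflect (normal_assembly n C) (C \in normal_assemblies n).
Proof.
rewrite in_fset_set; last exact: finite_normal_assemblies.
by apply: (iffP idP); rewrite inE.
Qed.

(** The factor 2 bounds the number of orientations of the root, and the power of [a] accounts for
    the root's studs in the initial queue. *)
Lemma card_normal_assemblies_le (R : realType) (a q : R) n :
  1 <= a -> 0 < q ->
  (size orientations * (b * w))%:R * a ^+ (2 * (b * w)) <= (a - 1) * q ->
  #|` normal_assemblies n.+1|%:R <= 2 * a ^+ (2 * (b * w)) * q ^+ n.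
Proof.
move=> a1 q0 aq.
have sz o : (size (explore n [fset (origin, o)] (studs (origin, o))))%:R
    <= a ^+ (2 * (b * w)) * q ^+ n.
  by rewrite -(size_studs (origin, o)); exact: size_explore.
apply: le_trans (_ : (size (normal_assemblies_seq n.+1))%:R <= _).
  rewrite ler_nat; apply: uniq_leq_size => // C.
  by move=> /normal_assembliesP/mem_normal_assemblies_seq.
rewrite -mulrA mulr2n mulrDl mul1r /normal_assemblies_seq /orientations.
have := sz true; have := sz false.
set A := explore n [fset (origin, false)] _; set A' := explore n _ _.
case: ifP => _ /=; rewrite ?cats0 ?size_cat ?natrD; last exact: lerD.
by move=> s1 s2; rewrite ler_wpDr// mulr_ge0 ?exprn_ge0 ?ltW// (lt_le_trans _ a1).
Qed.

(** * Gluing assemblies *)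

Lemma assembly_glue (A B : {fset blk}) c d v : assembly A -> assembly B ->
  c \in A -> {in A, forall e, level e <= level c} ->
  d \in B -> {in B, forall e, level d <= level e} ->
  level (move_block v d) = level c + 1 -> xyoverlap c (move_block v d) ->
  assembly (A `|` move_blocks v B).
Proof.
move=> cA /(assembly_move_blocks v); set B' := move_blocks v B => cB' cA_ cmax dB dmin vz ov.
have dB' : move_block v d \in B' by rewrite mem_move_blocks.
have d'min : {in B', forall e, level c + 1 <= level e}.
  move=> _ /move_blocksP[e eB ->]; rewrite -vz /level /= lerD2r; exact: dmin.
have st : stacked c (move_block v d) by rewrite /stacked vz eqxx.
move: B' cB' dB' d'min st {ov vz dmin dB} => B'; move: (move_block v d) => {v d}d.
move=> [Bo Bd Bc] dB dmin st; case: cA => Ao Ad Ac.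
have cAB : c \in A `|` B' by rewrite inE cA_.
have dAB : d \in A `|` B' by rewrite inE dB orbT.
split.
- by move=> x; rewrite inE => /orP[/Ao|/Bo].
- move=> x y; rewrite !inE => /orP[xA|xB] /orP[yA|yB] xy; [exact: Ad| | |exact: Bd].
    by case/andP: xy => /eqP xy _; have := cmax _ xA; have := dmin _ yB; lia.
  by case/andP: xy => /eqP xy _; have := cmax _ yA; have := dmin _ xB; lia.
have AB x y : clos_refl_trans _ (stacked_in A) x y ->
    clos_refl_trans _ (stacked_in (A `|` B')) x y.
  by apply: clos_rt_sub => {x y} x y [? ? ?]; split=> //; rewrite inE; apply/orP; left.
have BB x y : clos_refl_trans _ (stacked_in B') x y ->
    clos_refl_trans _ (stacked_in (A `|` B')) x y.
  by apply: clos_rt_sub => {x y} x y [? ? ?]; split=> //; rewrite inE; apply/orP; right.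
have cd : clos_refl_trans _ (stacked_in (A `|` B')) c d by apply: rt_step; split.
have dc : clos_refl_trans _ (stacked_in (A `|` B')) d c.
  by apply: rt_step; split; rewrite // stackedC.
move=> x y; rewrite !inE => /orP[xA|xB] /orP[yA|yB].
- exact: AB (Ac _ _ xA yA).
- exact: rt_trans (AB _ _ (Ac _ _ xA cA_)) (rt_trans _ _ _ _ _ cd (BB _ _ (Bc _ _ dB yB))).
- exact: rt_trans (BB _ _ (Bc _ _ xB dB)) (rt_trans _ _ _ _ _ dc (AB _ _ (Ac _ _ cA_ yA))).
- exact: BB (Bc _ _ xB yB).
Qed.

Lemma normal_level_ge0 C c : normal C -> c \in C -> 0 <= level c.
Proof.
move=> [_ nC] /nC; case: c => [[[x y] z] o] /orP[/ltW//|].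
by rewrite /level /= => /andP[/eqP->].
Qed.

(** The choice among the blocks of highest level depends on [C] alone, so a gluing can be undone
    once its lower part is known. The default is not reached for normal [C]. *)
Definition top_block (C : {fset blk}) : blk :=
  xget (origin, false) [set c | c \in C /\ {in C, forall d, level d <= level c}]%classic.

Lemma top_blockP C : normal C ->
  top_block C \in C /\ {in C, forall d, level d <= level (top_block C)}.
Proof.
move=> [[ o /exists_max_level[c cC cmax]] _].
by rewrite /top_block; case: xgetP => [x _ []//|/(_ c)[]].
Qed.

(* Stack [B] on top of [A], the block of [B] at the origin going to the position
   [e], relative to the top block of [A], of the level above. *)
Definition glue (A : {fset blk}) (e : int * int) (B : {fset blk}) : {fset blk} :=
  let p := (top_block A).1 in A `|` move_blocks (p.1.1 + e.1, p.1.2 + e.2, p.2 + 1) B.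

(** The blocks coming from [B] lie strictly above level 0 and above [A]: the least position stays at
    the origin, and the cardinalities add up. *)
Lemma normal_assembly_glue m n A B o e : normal_assembly m A -> normal_assembly n B ->
  (origin, o) \in B -> xyoverlap (origin, (top_block A).2) ((e, 0), o) ->
  normal_assembly (m + n) (glue A e B).
Proof.
move=> [cA nA Am] [cB nB Bn] oB ov.
have [tA tmax] := top_blockP nA.
have t0 := normal_level_ge0 nA tA.
rewrite /glue; set v := (_, _, _).
have lB c : c \in move_blocks v B -> level (top_block A) < level c.
  move=> /move_blocksP[d dB ->]; have := normal_level_ge0 nB dB.
  by rewrite /v /level /=; lia.
split.
- apply: (assembly_glue cA cB tA tmax oB) => //.
  + by move=> d dB; rewrite [level (origin, o)]/=; exact: normal_level_ge0 nB dB.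
  + by rewrite /level/= add0r.
  move: ov; rewrite /v; case: (top_block A) => [[[x y] z] o'].
  rewrite /xyoverlap /overlap /=. lia.
- case: nA => -[ o' oA] nnA; split; first by exists o'; rewrite inE oA.
  move=> c; rewrite inE => /orP[/nnA//|/lB].
  by move=> /(le_lt_trans t0) c0; rewrite /nonneg_pos; apply/orP; left.
rewrite -Am -Bn -(card_move_blocks v B) -cardfsUI.
suff -> : A `&` move_blocks v B = fset0 by rewrite cardfs0 addn0.
apply/fsetP => c; rewrite !inE; apply/negbTE/negP => /andP[/tmax + /lB].
by move=> h1 h2; have := lt_le_trans h2 h1; rewrite ltxx.
Qed.

(** The lower part consists of the blocks up to the level of its top block. Hence the lower part
    with the lower top is contained in the other, and equal cardinalities make them equal. The rest
    is a shift of a normal assembly, which determines [B] and [e]. *)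
Lemma glue_inj m A A' B B' e e' : #|` A| = m -> #|` A'| = m ->
  normal A -> normal A' -> normal B -> normal B' ->
  glue A e B = glue A' e' B' -> [/\ A = A', e = e' & B = B'].
Proof.
have lev C (u : int * int) D c : normal C -> normal D -> c \in glue C u D ->
    (c \in C) = (level c <= level (top_block C)).
  move=> nC nD; have [tC tmax] := top_blockP nC.
  rewrite inE => /orP[cC|/move_blocksP[d dD ->]]; first by rewrite cC tmax.
  have lt : level (top_block C) < level (move_block ((top_block C).1.1.1 + u.1,
      (top_block C).1.1.2 + u.2, (top_block C).1.2 + 1) d).
    have := normal_level_ge0 nD dD; rewrite /level /=; lia.
  rewrite leNgt lt /=; apply/negP => /tmax.
  by rewrite leNgt lt.
move=> Am A'm nA nA' nB nB' E.
have AA' : A = A'.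
  wlog le : A A' B B' e e' Am A'm nA nA' nB nB' E /
      level (top_block A) <= level (top_block A').
    move=> H; have [le|/ltW le] := leP (level (top_block A)) (level (top_block A')).
      exact: H E le.
    by apply/esym; apply: H (esym E) le.
  apply/eqP; rewrite eqEfcard Am A'm leqnn andbT; apply/fsubsetP => c cA.
  have cg : c \in glue A e B by rewrite inE cA.
  rewrite (lev _ _ _ _ nA' nB' (etrans (congr1 (fun X => c \in X) (esym E)) cg)).
  by apply: le_trans le; rewrite -(lev _ _ _ _ nA nB cg).
rewrite -AA' in E nA' A'm *; move: E; rewrite /glue.
set v := (_, _, _); set v' := (_, _, _) => E.
have dis (u : int * int) D c : normal D -> c \in move_blocks ((top_block A).1.1.1 + u.1,
    (top_block A).1.1.2 + u.2, (top_block A).1.2 + 1) D -> c \notin A.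
  move=> nD cD; have cg : c \in glue A u D by rewrite inE cD orbT.
  rewrite (lev _ _ _ _ nA nD cg) -ltNge; case/move_blocksP: cD => d dD ->.
  have := normal_level_ge0 nD dD; rewrite /level /=; lia.
have : move_blocks v B = move_blocks v' B'.
  apply/fsetP => c; have [cA|cA] := boolP (c \in A).
    by apply/idP/idP => cB; [have := dis e _ _ nB cB | have := dis e' _ _ nB' cB]; rewrite cA.
  by move/fsetP: E => /(_ c); rewrite !inE (negbTE cA).
move=> /(normal_eq_move_blocks nB nB')[[]].
by case: e e' @v @v' {E} => [? ?] [? ?] /= /addrI -> /addrI -> ->.
Qed.

(** Offset [(0, 0)] is always allowed, since two blocks with the same corner overlap in
    projection. *)
Lemma card_normal_assembliesM m n :
  (#|` normal_assemblies m| * #|` normal_assemblies n| <= #|` normal_assemblies (m + n)|)%N.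
Proof.
rewrite -(@size_allpairs _ _ _ (fun A B => glue A (0, 0) B)).
apply: uniq_leq_size => [|_ /allpairsP[[A B] /= [/normal_assembliesP Am /normal_assembliesP Bn ->]]].
  apply: allpairs_uniq; rewrite ?fset_uniq//= => -[A B] [A' B'].
  move=> /allpairsP[[? ?] /= [/normal_assembliesP[_ nA Am] /normal_assembliesP[_ nB _] [-> ->]]].
  move=> /allpairsP[[? ?] /= [/normal_assembliesP[_ nA' A'm] /normal_assembliesP[_ nB' _] [-> ->]]].
  by move=> /(glue_inj Am A'm nA nA' nB nB')[-> _ ->].
have [[ o oB] _] : normal B by case: Bn.
apply/normal_assembliesP; apply: (normal_assembly_glue Am Bn oB).
have := xdim_gt0; have := ydim_gt0; rewrite /xyoverlap /overlap /= => x0 y0.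
by rewrite !add0r !ltz_nat !x0 !y0.
Qed.

(** * Adding a single block on top *)

Definition block_at_origin o : {fset blk} := [fset (origin, o)].

Lemma normal_assembly_block o : o \in orientations -> normal_assembly 1 (block_at_origin o).
Proof.
move=> oo; split; last by rewrite cardfs1.
  split=> [c /fset1P ->|c d /fset1P -> /fset1P ->|c d /fset1P -> /fset1P ->] //.
  exact: rt_refl.
by split=> [|c /fset1P ->]; [exists o; exact/fset1P|rewrite /nonneg_pos /=].
Qed.

(** These are the integers strictly between [- p] and [q]: the starting points of intervals of
    length [p] that overlap an interval of length [q] starting at 0. *)
Definition offsets (p q : nat) : seq int := [seq i.+1%:Z - p%:Z | i <- iota 0 (p + q - 1)%N].

Lemma mem_offsets (p q : nat) (i : int) : i \in offsets p q -> (0 < i + p%:Z) && (i < q%:Z).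
Proof. by move=> /mapP[j]; rewrite mem_iota => H ->; lia. Qed.

Lemma uniq_offsets (p q : nat) : uniq (offsets p q).
Proof. by rewrite map_inj_uniq ?iota_uniq// => i j; lia. Qed.

Definition extensions o : seq (bool * (int * int)) :=
  [seq (o', e) | o' <- orientations,
     e <- [seq (i, j) | i <- offsets (xdim o') (xdim o), j <- offsets (ydim o') (ydim o)]].

(** The first summand counts the placements parallel to the block underneath, the second those
    turned by a right angle, which are new only if [b] and [w] differ. *)
Definition growth : nat :=
  ((2 * b - 1) * (2 * w - 1) + (if b == w then 0 else (b + w - 1) ^ 2))%N.

Lemma size_extensions o : o \in orientations -> size (extensions o) = growth.
Proof.
rewrite /extensions size_allpairs_dep /growth /orientations.
case: ifP => bw.
  rewrite inE => /eqP -> /=; rewrite size_allpairs !size_map !size_iota.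
  by rewrite !addnn !mul2n.
move=> _ /=; rewrite !size_allpairs !size_map !size_iota addn0 !mul2n -!addnn.
by case: o => /=; rewrite (addnC w b) expnS expn1 // addnC [((b + b - 1) * _)%N]mulnC.
Qed.

(** The available extensions depend on the orientation of the top block, but their number does not;
    gluing a single block is injective. *)
Lemma card_normal_assembliesS n :
  (growth * #|` normal_assemblies n| <= #|` normal_assemblies n.+1|)%N.
Proof.
pose g A (f : bool * (int * int)) := glue A f.2 (block_at_origin f.1).
pose s := [seq g A f | A <- normal_assemblies n, f <- extensions (top_block A).2].
have Ao A : normal_assembly n A -> (top_block A).2 \in orientations.
  by case=> -[Ao _ _] nA _; apply: Ao; case: (top_blockP nA).
have <- : size s = (growth * #|` normal_assemblies n|)%N.
  rewrite size_allpairs_dep -sum1_size big_distrr/= sumnE big_map.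
  apply: eq_big_seq => A /normal_assembliesP/Ao oo; rewrite muln1; exact: size_extensions.
have ext o f : f \in extensions o -> [/\ f.1 \in orientations &
     xyoverlap (origin, o) ((f.2, 0), f.1)].
  case/allpairsPdep => o' [[i j] /= [oo /allpairsP[[? ?] /= [/mem_offsets ii /mem_offsets jj [-> ->]]] ->]].
  split=> //; rewrite /xyoverlap /overlap /=; lia.
apply: uniq_leq_size.
  apply: allpairs_uniq_dep; first exact: fset_uniq.
    move=> A _; apply: allpairs_uniq_dep => //.
    - by rewrite /orientations; case: ifP.
    - move=> o _; apply: allpairs_uniq; rewrite ?uniq_offsets//.
      by move=> [? ?] [? ?] /= _ _ [-> ->].
    - by move=> [? ?] [? ?] /= _ _ [-> ->].
  move=> x y /allpairsPdep[A [[ o e] [/normal_assembliesP[_ nA An] /ext[oo _] ->]]].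
  move=> /allpairsPdep[A' [[ o' e'] [/normal_assembliesP[_ nA' A'n] /ext[oo' _] ->]]] /=.
  have [[_ nB _] [_ nB' _]] := (normal_assembly_block oo, normal_assembly_block oo').
  by move=> /(glue_inj An A'n nA nA' nB nB')[-> /= -> /fset1_inj[/= ->]].
move=> _ /allpairsPdep[A [f [/normal_assembliesP An /ext[oo ov] ->]]].
apply/normal_assembliesP; rewrite -addn1.
apply: (normal_assembly_glue An (normal_assembly_block oo) _ ov).
exact/fset1P.
Qed.

Lemma growth_pow n : (growth ^ n <= #|` normal_assemblies n.+1|)%N.
Proof.
elim: n => [|n IHn]; last first.
  by rewrite expnS (leq_trans _ (card_normal_assembliesS _))// leq_mul2l IHn orbT.
rewrite expn0 cardfs_gt0; apply/fset0Pn; exists (block_at_origin false).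
apply/normal_assembliesP/normal_assembly_block.
by rewrite /orientations; case: ifP.
Qed.

End Combinatorics.

(** * From integer coordinates to solid blocks *)

Lemma nbhs_setX (T U : topologicalType) (x : T * U) (A : set T) (B : set U) :
  nbhs x (A `*` B)%classic <-> nbhs x.1 A /\ nbhs x.2 B.
Proof.
split=> [[[P Q] /= [xP xQ] PQ]|[xA xB]]; last by exists (A, B).
split; [apply: filterS xP => y Py|apply: filterS xQ => y Qy].
  by case: (PQ (y, x.2)) => //; split=> //=; exact: nbhs_singleton xQ.
by case: (PQ (x.1, y)) => //; split=> //=; exact: nbhs_singleton xP.
Qed.

Lemma nbhs_itvcc (R : realType) (a b x : R) : nbhs x `[a, b]%classic <-> a < x < b.
Proof.
have <- : (`[a, b]%classic°)%classic x <-> a < x < b.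
  by rewrite interior_itv_bnd /= in_itv.
by [].
Qed.

Section Geometry.
Local Open Scope fset_scope.
Local Open Scope classical_set_scope.
Local Open Scope ring_scope.
Variables (R : realType) (b w : nat).
Hypotheses (b_gt0 : (0 < b)%N) (w_gt0 : (0 < w)%N).

Notation pos := (int * int * int)%type.
Notation blk := (pos * bool)%type.
Notation R3 := (R * R * R)%type.
Notation orientations := (orientations b w).
Notation xdim := (xdim b w).
Notation ydim := (ydim b w).

Implicit Types (C D : {fset blk}) (c d : blk) (u v t : R3) (o : bool).

Definition solid (c : blk) : set R3 :=
  box c.1.1.1 c.1.1.2 c.1.2 (xdim c.2) (ydim c.2).

Definition solids (C : {fset blk}) : set (set R3) := [set solid c | c in [set` C]].

Definition vec (p : pos) : R3 := (p.1.1%:~R, p.1.2%:~R, p.2%:~R).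

Lemma solidP c u : solid c u <->
  [/\ (c.1.1.1)%:~R <= u.1.1 <= (c.1.1.1)%:~R + (xdim c.2)%:R,
      (c.1.1.2)%:~R <= u.1.2 <= (c.1.1.2)%:~R + (ydim c.2)%:R &
      (c.1.2)%:~R <= u.2 <= (c.1.2)%:~R + 1].
Proof.
by rewrite /solid /box /= !in_itv /=; split=> [[[? ?] ?]|[? ? ?]].
Qed.

(** For [b = w] the two forms of a block are the same box, so orientation [false] represents
    both. *)
Lemma block_atP z (A : set R3) : block_at b w z A <->
  exists c, [/\ level c = z, c.2 \in orientations & A = solid c].
Proof.
split.
  rewrite /orientations; case: eqP => bw [x [y]].
    by rewrite -bw => -[]->; exists ((x, y, z), false); split; rewrite // /solid /= -bw.
  by case=> ->; [exists ((x, y, z), false)|exists ((x, y, z), true)].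
by case=> -[[[x y] z'] o] [/= <- _ ->]; exists x, y; case: o; [right|left].
Qed.

Lemma dims_inj o o' : o \in orientations -> o' \in orientations ->
  xdim o = xdim o' -> ydim o = ydim o' -> o = o'.
Proof.
rewrite /orientations; case: eqP; first by rewrite !inE => _ /eqP -> /eqP ->.
by case: o o' => [] [] //= /nesym.
Qed.

Lemma translation_solid (p : pos) c :
  translation (vec p) @` solid c = solid (move_block p c).
Proof.
apply/seteqP; split=> [_ [u /solidP[ux uy uz] <-]|u /solidP[/= ux uy uz]].
  by apply/solidP; rewrite /= !intrD; split; lra.
exists (u - vec p); last by rewrite /translation subrK.
by apply/solidP; rewrite /= !intrD in ux uy uz *; split; lra.
Qed.

(** Comparing the least and greatest corners in both directions forces equal side lengths and makes
    [t] the difference of two integer corners. *)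
Lemma translation_solid_eq t c d : c.2 \in orientations -> d.2 \in orientations ->
  translation t @` solid c = solid d ->
  exists2 p, t = vec p & d = move_block p c.
Proof.
move: t c d => [[tx ty] tz] [[[x y] z] o] [[[x' y'] z'] o'] /= oo oo' E.
pose lo := (x%:~R, y%:~R, z%:~R) : R3.
pose hi := (x%:~R + (xdim o)%:R, y%:~R + (ydim o)%:R, z%:~R + 1) : R3.
pose lo' := (x'%:~R, y'%:~R, z'%:~R) : R3.
pose hi' := (x'%:~R + (xdim o')%:R, y'%:~R + (ydim o')%:R, z'%:~R + 1) : R3.
have [? ? ? ?] : [/\ 0 <= (xdim o)%:R :> R, 0 <= (ydim o)%:R :> R,
   0 <= (xdim o')%:R :> R & 0 <= (ydim o')%:R :> R] by [].
have /solidP/=[H1 H2 H3] : solid (x', y', z', o') (lo + (tx, ty, tz)).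
  by rewrite -E; exists lo => //; apply/solidP; rewrite /lo /=; split; lra.
have /solidP/=[H4 H5 H6] : solid (x', y', z', o') (hi + (tx, ty, tz)).
  by rewrite -E; exists hi => //; apply/solidP; rewrite /hi /=; split; lra.
have : solid (x', y', z', o') lo' by apply/solidP; rewrite /lo' /=; split; lra.
rewrite -E => -[[[ux uy] uz] /solidP/=[H7 H8 H9]] [ex ey ez].
have : solid (x', y', z', o') hi' by apply/solidP; rewrite /hi' /=; split; lra.
rewrite -E => -[[[vx vy] vz] /solidP/=[H10 H11 H12]] [fx fy fz].
have dx : (xdim o)%:R = (xdim o')%:R :> R by lra.
have dy : (ydim o)%:R = (ydim o')%:R :> R by lra.
have -> : o' = o.
  by apply/esym/dims_inj => //; apply/eqP; rewrite -(eqr_nat R) ?dx ?dy.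
exists (x' - x, y' - y, z' - z).
  have [-> -> ->] : [/\ tx = x'%:~R - x%:~R, ty = y'%:~R - y%:~R & tz = z'%:~R - z%:~R].
    by split; lra.
  by rewrite /vec /= !intrB.
by rewrite /move_block /= !subrKC.
Qed.

Lemma solid_inj c d : c.2 \in orientations -> d.2 \in orientations ->
  solid c = solid d -> c = d.
Proof.
move=> oc od cd; have : translation (0, 0, 0) @` solid c = solid d.
  rewrite -cd; apply/seteqP; split=> [_ [u cu <-]|u cu].
    by rewrite /translation addr0.
  by exists u; rewrite // /translation addr0.
move=> /(translation_solid_eq oc od)[[[px py] pz] [px0 py0 pz0] ->].
move/eqP: px0; move/eqP: py0; move/eqP: pz0.
rewrite ![0 == _]eq_sym !intr_eq0 => /eqP -> /eqP -> /eqP ->.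
by case: c {oc cd} => [[[? ?] ?] ?]; rewrite /move_block /= !addr0.
Qed.

Lemma nbhs_solid c u : nbhs u (solid c) <->
  [/\ (c.1.1.1)%:~R < u.1.1 < (c.1.1.1)%:~R + (xdim c.2)%:R,
      (c.1.1.2)%:~R < u.1.2 < (c.1.1.2)%:~R + (ydim c.2)%:R &
      (c.1.2)%:~R < u.2 < (c.1.2)%:~R + 1].
Proof.
rewrite /solid /box; split.
  by move=> /nbhs_setX[/nbhs_setX[/nbhs_itvcc ? /nbhs_itvcc ?] /nbhs_itvcc ?].
by move=> [? ? ?]; apply/nbhs_setX; split; [apply/nbhs_setX; split|]; exact/nbhs_itvcc.
Qed.

Lemma open_overlap (x x' : int) (p p' : nat) :
  (0 < p)%N -> (0 < p')%N ->
  (exists2 r : R, x%:~R < r < x%:~R + p%:R & x'%:~R < r < x'%:~R + p'%:R) <->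
  overlap x p x' p'.
Proof.
move=> p0 p'0; rewrite /overlap; split.
  move=> [r /andP[r1 r2] /andP[r3 r4]].
  rewrite -!(ltr_int R) !intrD; apply/andP; split; lra.
move=> H; pose i := Num.max x x'.
have [ix ip ix' ip'] : [/\ x <= i, i + 1 <= x + p%:Z, x' <= i & i + 1 <= x' + p'%:Z].
  by rewrite /i; split; lia.
move: ix ip ix' ip'; rewrite -!(ler_int R) !intrD => *.
(* The intervals have integer ends, so they share the unit interval starting at [i], and its
   midpoint is interior to both. *)
by exists (i%:~R + 2^-1); lra.
Qed.

Lemma overlap1 (x x' : int) : overlap x 1 x' 1 = (x == x').
Proof. by rewrite /overlap; lia. Qed.

Lemma interior_solidI c d :
  ((solid c)° `&` (solid d)°)%classic !=set0 <-> clash b w c d.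
Proof.
have := (xdim_gt0 b_gt0 w_gt0, ydim_gt0 b_gt0 w_gt0) => -[x0 y0].
rewrite /clash /xyoverlap /level; split.
  move=> [u [/nbhs_solid[c1 c2 c3] /nbhs_solid[d1 d2 d3]]].
  (* The heights are intervals of length 1 with integer ends, which overlap only when they
     coincide. *)
  have /open_overlap H : exists2 r : R, (c.1.2)%:~R < r < (c.1.2)%:~R + 1%:R & (d.1.2)%:~R < r < (d.1.2)%:~R + 1%:R by exists u.2.
  apply/and3P; split.
  - by rewrite -overlap1 H.
  - by apply/open_overlap => //; exists u.1.1.
  - by apply/open_overlap => //; exists u.1.2.
case/and3P => /eqP cd /open_overlap-/(_ (x0 _) (x0 _))[rx cx dx].
move=> /open_overlap-/(_ (y0 _) (y0 _))[ry cy dy].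
exists (rx, ry, (c.1.2)%:~R + 2^-1); split; apply/nbhs_solid; split => //=; rewrite -?cd; lra.
Qed.

Lemma xy_projection_solid c : xy_projection (solid c) =
  `[(c.1.1.1)%:~R, (c.1.1.1)%:~R + (xdim c.2)%:R] `*`
  `[(c.1.1.2)%:~R, (c.1.1.2)%:~R + (ydim c.2)%:R].
Proof.
apply/seteqP; split=> [_ [u [? _] <-]//|u cu].
by exists (u, (c.1.2)%:~R) => //; split=> //=; rewrite in_itv /= lexx lerDl ler01.
Qed.

Lemma interior_xy_projectionI c d :
  ((xy_projection (solid c) `&` xy_projection (solid d))°)%classic !=set0 <->
  xyoverlap b w c d.
Proof.
have := (xdim_gt0 b_gt0 w_gt0, ydim_gt0 b_gt0 w_gt0) => -[x0 y0].
rewrite !xy_projection_solid interiorI /xyoverlap; split.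
  move=> [u [/nbhs_setX[/nbhs_itvcc ? /nbhs_itvcc ?] /nbhs_setX[/nbhs_itvcc ? /nbhs_itvcc ?]]].
  by apply/andP; split; apply/open_overlap => //; [exists u.1|exists u.2].
case/andP => /open_overlap-/(_ (x0 _) (x0 _))[rx cx dx].
move=> /open_overlap-/(_ (y0 _) (y0 _))[ry cy dy].
by exists (rx, ry); split; apply/nbhs_setX; split; exact/nbhs_itvcc.
Qed.

(** [levels_adjacent] only asks for some description of each box at a given level; [solid_inj] makes
    that description, and so the level, unique. *)
Lemma attached_solid c d : c.2 \in orientations -> d.2 \in orientations ->
  attached b w (solid c) (solid d) <-> stacked b w c d.
Proof.
move=> oc od; rewrite /attached interior_xy_projectionI /stacked.
have lev : levels_adjacent b w (solid c) (solid d) <->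
    (level d == level c + 1) || (level c == level d + 1).
  split.
    move=> [z []] [/block_atP[c' [<- oc' cc']] /block_atP[d' [z' od' dd']]].
      by rewrite (solid_inj oc oc' cc') (solid_inj od od' dd') z' eqxx.
    by rewrite (solid_inj oc od' dd') (solid_inj od oc' cc') z' eqxx orbT.
  case/orP=> /eqP E; [exists (level c); left|exists (level d); right].
    by split; apply/block_atP; [exists c|exists d].
  by split; apply/block_atP; [exists d|exists c].
split=> [[/lev -> ->]//|/andP[/lev ? ?]]; by split.
Qed.

Definition valid C := {in C, forall c, c.2 \in orientations}.

Lemma mem_solids C c : valid C -> c.2 \in orientations ->
  solids C (solid c) <-> c \in C.
Proof.
move=> Co oc; split=> [[d /= dC /solid_inj dc]|cC]; last by exists c.
by rewrite -dc//; exact: Co.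
Qed.

Lemma solids_inj C D : valid C -> valid D -> solids C = solids D -> C = D.
Proof.
move=> Co Do CD; apply/fsetP => c; apply/idP/idP => cC.
  by apply/(mem_solids Do (Co _ cC)); rewrite -CD; exists c.
by apply/(mem_solids Co (Do _ cC)); rewrite CD; exists c.
Qed.

Lemma card_solids C : valid C -> (solids C #= `I_(#|` C|))%card.
Proof.
move=> Co; apply: card_eq_trans (_ : ([set` C] #= _)%card).
  apply: inj_card_eq => c d; rewrite !inE => cC dC.
  exact: solid_inj (Co _ cC) (Co _ dC).
exact/card_eq_fsetP.
Qed.

Lemma assembly_contiguous_building C : assembly b w C ->
  contiguous_buildings b w #|` C| (solids C).
Proof.
move=> [Co Cd Cc]; split; last exact: card_solids.
  split.
  - exact: finite_image.
  - move=> _ [c cC <-]; exists (level c); apply/block_atP; exists c; split=> //.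
    exact: Co.
  - move=> _ _ [c cC <-] [d dC <-] /interior_solidI /(Cd _ _ cC dC) -> //.
move=> _ _ [c cC <-] [d dC <-].
apply: (clos_rt_homo _ (Cc _ _ cC dC)) => x y [xC yC xy].
split; [by exists x|by exists y|].
by apply/attached_solid => //; exact: Co.
Qed.

(** By [solid_inj] each block of [B] has exactly one code. The decoding map [f] carries finiteness
    and chains of attachments from [B] over to the set of codes. *)
Lemma contiguous_building_assembly n (B : set (set R3)) :
  contiguous_buildings b w n B ->
  exists C, [/\ assembly b w C, #|` C| = n & solids C = B].
Proof.
move=> [[Bfin Bblock Bdis] Bcont Bn].
pose P (c : blk) := c.2 \in orientations /\ B (solid c).
pose f (A : set R3) : blk := xget ((0, 0, 0), false) [set c | P c /\ solid c = A].
have fP A : B A -> P (f A) /\ solid (f A) = A.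
  move=> BA; have [z /block_atP[c [_ oc Ac]]] := Bblock _ BA.
  rewrite /f; case: xgetP => [c' -> //|/(_ c)/= []].
  by rewrite /P -Ac.
have Pfin : finite_set [set c | P c].
  apply: (sub_finite_set _ (finite_image f Bfin)) => c [oc Bc].
  exists (solid c) => //; have [[? _] /solid_inj] := fP _ Bc; exact.
pose C : {fset blk} := fset_set [set c | P c].
have CP c : c \in C <-> P c by rewrite /C in_fset_set// inE.
have Co : valid C by move=> c /CP[].
have CB : solids C = B.
  apply/seteqP; split=> [_ [c /CP[_ ?] <-]//|A BA].
  by have [Pf fA] := fP _ BA; exists (f A) => //; exact/CP.
exists C; split=> //.
  split=> // c d cC dC.
    move/interior_solidI => cd; apply: solid_inj; [exact: Co|exact: Co|].
    by apply: Bdis cd; rewrite -CB; [exists c|exists d].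
  have Bc : B (solid c) by rewrite -CB; exists c.
  have Bd : B (solid d) by rewrite -CB; exists d.
  have fK e : P e -> f (solid e) = e.
    by move=> [oe Be]; have [[? _] /solid_inj] := fP _ Be; exact.
  rewrite -(fK c); last exact/CP.
  rewrite -(fK d); last exact/CP.
  apply: (@clos_rt_homo _ _ _ _ f _ _ _ (Bcont _ _ Bc Bd)) => A A' [BA BA' AA'].
  have [PA fA] := fP _ BA; have [PA' fA'] := fP _ BA'.
  split; [exact/CP|exact/CP|].
  by apply/attached_solid; [case: PA|case: PA'|rewrite fA fA'].
have := card_solids Co; rewrite CB => BC.
rewrite -(card_fset_set BC); exact: card_fset_set Bn.
Qed.

End Geometry.

(** * Motions and classes of buildings *)

Section Motions.
Local Open Scope classical_set_scope.
Local Open Scope ring_scope.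
Variable R : realType.
Notation R3 := (R * R * R)%type.
Implicit Types (u t : R3).

Definition turn u : R3 := (- u.1.2, u.1.1, u.2).

Lemma iter_turnD k u t : iter k turn (u + t) = iter k turn u + iter k turn t.
Proof.
elim: k => //= k ->; move: (iter k turn u) (iter k turn t) => [[x y] z] [[x' y'] z'].
by rewrite /turn /= opprD.
Qed.

Lemma iter_turn_modn k u : iter k turn u = iter (k %% 4) turn u.
Proof.
rewrite {1}(divn_eq k 4) addnC iterD; congr (iter _ _ _).
elim: (k %/ 4)%N => // q IHq; rewrite mulSn iterD IHq /=.
by case: u {IHq} => [[x y] z]; rewrite /turn /= !opprK.
Qed.

(** A quarter turn about any vertical axis is [turn] followed by a translation. As [turn] is
    additive of order four, compositions keep this form. *)
Lemma motion_turn (f : R3 -> R3) : motion f ->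
  exists2 k, (k < 4)%N & exists t, f = translation t \o iter k turn.
Proof.
suff : motion f -> exists k t, forall u, f u = iter k turn u + t.
  move=> H /H[k [t ft]]; exists (k %% 4)%N; first by rewrite ltn_mod.
  by exists t; apply/funext => u; rewrite ft iter_turn_modn.
elim=> {f} [t|c k|f g _ [k [t ft]] _ [j [s gs]]].
- by exists 0%N, t.
- exists k; elim: k => [|k [t kt]]; first by exists 0 => u; rewrite addr0.
  (* The second vector is the image of the origin under [quarter_turn c]. *)
  exists (turn t + (c.1 + c.2, c.2 - c.1, 0)) => u; rewrite /= kt.
  move: (iter k turn u) => v; rewrite addrA -(iter_turnD 1)/= /quarter_turn /turn.
  congr (_, _, _) => /=; ring.
- exists (k + j)%N, (iter k turn s + t) => u /=.
  by rewrite gs ft iter_turnD iterD addrA.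
Qed.

(** Motions with the same angle differ by a translation, which normalization will rule out. *)
Lemma motion_translation_comp k t t' :
  translation t' \o iter k turn = translation (t' - t) \o (translation t \o iter k turn).
Proof. by apply/funext => u; rewrite /translation /= -addrA [t + _]addrC subrK. Qed.

Lemma image_image_comp (f g : R3 -> R3) (B : set (set R3)) :
  [set (f \o g) @` A | A in B] = [set f @` A | A in [set g @` A | A in B]].
Proof.
apply/seteqP; split=> [_ [A BA <-]|_ [_ [A BA <-] <-]].
  by exists (g @` A); [exists A|rewrite image_comp].
by exists A => //; rewrite image_comp.
Qed.

Lemma identified_refl (B : set (set R3)) : identified B B.
Proof.
exists (translation 0); first exact: motion_translation.
suff -> : (fun A : set R3 => translation 0 @` A) = id by rewrite image_id.
apply/funext => A; suff -> : translation 0 = (id : R3 -> R3) by rewrite image_id.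
by apply/funext => u; rewrite /translation addr0.
Qed.

Lemma identified_trans (B1 B2 B3 : set (set R3)) :
  identified B1 B2 -> identified B2 B3 -> identified B1 B3.
Proof.
move=> [f mf <-] [g mg <-]; exists (g \o f); first exact: motion_comp.
by rewrite image_image_comp.
Qed.

End Motions.

(** * Counting classes through normalized assemblies *)

Section Counting.
Local Open Scope fset_scope.
Local Open Scope classical_set_scope.
Local Open Scope ring_scope.
Variables (R : realType) (b w : nat).
Hypotheses (b_gt0 : (0 < b)%N) (w_gt0 : (0 < w)%N).

Notation pos := (int * int * int)%type.
Notation blk := (pos * bool)%type.
Notation R3 := (R * R * R)%type.
Notation orientations := (orientations b w).
Notation solid := (@solid R b w).
Notation solids := (@solids R b w).
Notation vec := (vec R).

Implicit Types (C D : {fset blk}) (c d : blk) (p : pos) (n : nat).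

Lemma translation_solids p C :
  [set translation (vec p) @` A | A in solids C] = solids (move_blocks p C).
Proof.
apply/seteqP; split=> [_ [_ [c cC <-] <-]|_ [_ /move_blocksP[c cC ->] <-]].
  by exists (move_block p c); rewrite /= ?mem_move_blocks// translation_solid.
by exists (solid c); [exists c|rewrite translation_solid].
Qed.

Lemma identified_move_blocks p C : identified (solids C) (solids (move_blocks p C)).
Proof.
exists (translation (vec p)); first exact: motion_translation.
exact: translation_solids.
Qed.

(** Since [t] carries one block to another, it is an integer vector, and a nonzero shift cannot
    relate two normal assemblies. *)
Lemma translation_normal_eq t C D : valid b w C -> valid b w D ->
  normal C -> normal D ->
  [set translation t @` A | A in solids C] = solids D -> C = D.
Proof.
move=> Co Do nC nD CD; have [[ o oC] _] := nC.
have : solids D (translation t @` solid (origin, o)).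
  by rewrite -CD; exists (solid (origin, o)) => //; exists (origin, o).
move=> [d dD /esym/(translation_solid_eq (Co _ oC) (Do _ dD))[p tp _]].
have Cpo : valid b w (move_blocks p C).
  by move=> _ /move_blocksP[c cC ->]; exact: (Co _ cC).
have : move_blocks p C = D.
  by apply: (@solids_inj R b w) => //; rewrite -translation_solids -tp.
have D0 : move_blocks origin D = D.
  apply/fsetP => c; rewrite -(mem_move_blocks origin D c).
  by case: c => [[[x y] z] o']; rewrite /move_block /= !addr0.
by rewrite -{1}D0 => /(normal_eq_move_blocks nC nD)[].
Qed.

Definition class n C : set (set (set R3)) :=
  [set B | contiguous_buildings b w n B /\ identified (solids C) B].

Lemma contiguous_solids n C : normal_assembly b w n C ->
  contiguous_buildings b w n (solids C).
Proof. by move=> [aC _ <-]; exact: assembly_contiguous_building. Qed.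

(** Positivity of [n] provides a block to move to the origin. The shift and its inverse show that a
    building and its normal form have the same class. *)
Lemma building_classesE n : (0 < n)%N ->
  building_classes b w n = [set class n C | C in [set C | normal_assembly b w n C]].
Proof.
move=> n0; apply/seteqP; split=> [_ [B cB <-]|_ [C nC <-]]; last first.
  by exists (solids C) => //; exact: contiguous_solids.
have [C [aC Cn CB]] := contiguous_building_assembly b_gt0 w_gt0 cB.
have [p nC] : exists p, normal (move_blocks p C).
  by apply: exists_normal_move_blocks; rewrite Cn.
exists (move_blocks p C).
  by split; [exact: assembly_move_blocks| |rewrite card_move_blocks].
have pC := identified_move_blocks p C.
have := identified_move_blocks (opp_pos p) (move_blocks p C).
rewrite move_blocksK CB in pC *; rewrite /class => Cp.
apply/seteqP; split=> B' [cB' idB']; split=> //.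
  exact: identified_trans pC idB'.
exact: identified_trans Cp idB'.
Qed.

Lemma building_countE n : (0 < n)%N ->
  building_count R b w n = #|` [fset class n C | C in normal_assemblies b w n]|.
Proof.
move=> n0; rewrite /building_count building_classesE// fset_set_image//.
exact: finite_normal_assemblies.
Qed.

(* A normalized assembly is determined by its class and by the angle of a motion
   from a representative of that class. *)
Lemma building_count_bounds n : (0 < n)%N ->
  (building_count R b w n <= #|` normal_assemblies b w n|
     <= 4 * building_count R b w n)%N.
Proof.
move=> n0; rewrite building_countE// leq_imfset_card /=.
set N := normal_assemblies b w n.
(* On members of [N], neither the default of [rep] nor that of [angle] is reached: the class comes
   from [N], and [motion_turn] yields an angle below 4. *)
pose rep X := xget fset0 [set C | C \in N /\ class n C = X].
have repP C : C \in N -> rep (class n C) \in N /\ class n (rep (class n C)) = class n C.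
  by move=> CN; rewrite /rep; case: xgetP => [D _ //|/(_ C)/= []].
pose turned k C D := (k < 4)%N /\
  exists t, [set (translation t \o iter k (@turn R)) @` A | A in solids C] = solids D.
pose angle C := xget 0%N [set k | turned k (rep (class n C)) C].
have angleP C : C \in N -> turned (angle C) (rep (class n C)) C.
  move=> CN; rewrite /angle; case: xgetP => [k _ //|nok].
  have [rN rC] := repP _ CN.
  have : class n C (solids C).
    split; last exact: identified_refl.
    by apply: contiguous_solids; exact/normal_assembliesP.
  rewrite -rC => -[_ [f /motion_turn[k k4 [t ->]] ft]].
  by case: (nok k); split=> //; exists t.
pose g C := (angle C, class n C).
have gi : {in N &, injective g}.
  move=> C D CN DN [kE cE].
  have [_ [t tC]] := angleP _ CN; have [_ [s sD]] := angleP _ DN.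
  have /(normal_assembliesP b_gt0 w_gt0)[[Co _ _] nC _] := CN.
  have /(normal_assembliesP b_gt0 w_gt0)[[Do _ _] nD _] := DN.
  (* Both assemblies arise from the same representative by motions with the same angle, so this
     translation takes one to the other. *)
  apply: (@translation_normal_eq (s - t)) => //.
  by rewrite -tC -sD -kE -cE (motion_translation_comp _ t s) [RHS]image_image_comp.
pose s := [seq (k, X) | k <- iota 0 4, X <- [fset class n C | C in N]].
rewrite -(size_map g); apply: leq_trans (_ : size s <= _)%N; last by rewrite size_allpairs.
apply: uniq_leq_size; first by rewrite map_inj_in_uniq ?fset_uniq.
move=> _ /mapP[C CN ->]; apply/allpairsP; exists (g C).
split=> //; first by rewrite mem_iota; case: (angleP _ CN).
by apply/imfsetP; exists C.
Qed.

Lemma exp_entropy_bounds (a q : R) : 1 < a -> 0 < q ->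
  (size orientations * (b * w))%:R * a ^+ (2 * (b * w)) <= (a - 1) * q ->
  (growth b w)%:R <= exp_entropy R b w <= q.
Proof.
move=> a1 q0 aq.
apply: (@growth_rate_bounds _ (fun n => #|` normal_assemblies b w n|) _ 1 _ _
   (2 * a ^+ (2 * (b * w))) 4) => //.
- by move=> m n _ _; exact: card_normal_assembliesM.
- exact: building_count_bounds.
- rewrite ltr0n /growth; nia.
- by rewrite mulr_gt0// exprn_gt0// (lt_trans _ a1).
- by move=> n; rewrite mul1r -natrX ler_nat; exact: growth_pow.
- by move=> n; apply: card_normal_assemblies_le => //; exact: ltW.
Qed.

End Counting.

(** * The explicit bounds *)

Lemma div_subr1_gt1 (F : realFieldType) (x : F) : 1 < x -> 1 < x / (x - 1).
Proof. by move=> x1; rewrite ltr_pdivlMr ?subr_gt0// mul1r ltrBlDr ltrDl. Qed.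

Lemma growth_bound_gt0 (F : realFieldType) (x : F) (k : nat) :
  1 < x -> 0 < x ^+ (k + 1) / (x - 1) ^+ (k - 1).
Proof.
by move=> x1; rewrite divr_gt0 ?exprn_gt0 ?subr_gt0// (lt_trans _ x1).
Qed.

(** For [a = x / (x - 1)] one has [a - 1 = 1 / (x - 1)], and both sides are
    [x ^+ (k + 1) / (x - 1) ^+ k]: the exploration condition holds with equality. *)
Lemma growth_bound_eq (F : realFieldType) (x : F) (k : nat) : 1 < x -> (0 < k)%N ->
  x * (x / (x - 1)) ^+ k = (x / (x - 1) - 1) * (x ^+ (k + 1) / (x - 1) ^+ (k - 1)).
Proof.
move=> x1; case: k => // k _; have y0 : x - 1 != 0 by rewrite subr_eq0 gt_eqF.
rewrite addn1 subn1 /= expr_div_n !exprS; field.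
by rewrite y0 expf_neq0.
Qed.

Theorem theorem2p10 (R : realType) (b w : nat) (hb : (0 < b)%N) (hw : (0 < w)%N) :
  (b <> w ->
     (2 * b%:R - 1) * (2 * w%:R - 1) + (b%:R + w%:R - 1) ^+ 2 <= exp_entropy R b w /\
     exp_entropy R b w <= (2 * b%:R * w%:R) ^+ (2 * b * w + 1)
                / (2 * b%:R * w%:R - 1) ^+ (2 * b * w - 1)) /\
  (b = w ->
     (2 * b%:R - 1) ^+ 2 <= exp_entropy R b w /\
     ((exp_entropy R b w)%:E <=
        if b == 1%N then +oo
        else ((b%:R ^+ 2) ^+ (2 * b ^ 2 + 1)
              / (b%:R ^+ 2 - 1) ^+ (2 * b ^ 2 - 1))%:E)%E).
Proof.
have lower_bound : (growth b w)%:R <= exp_entropy R b w.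
  pose L : R := (size (orientations b w) * (b * w))%:R.
  (* The lower bound involves neither [a] nor [q], so any admissible pair serves; [a = 2] also
     covers [b = w = 1], where [x / (x - 1)] would have denominator zero. *)
  pose q := L * 2 ^+ (2 * (b * w)).
  have q0 : 0 < q.
    rewrite mulr_gt0 ?exprn_gt0// ltr0n !muln_gt0 hb hw /orientations.
    by case: ifP.
  have Lq : L * 2 ^+ (2 * (b * w)) <= (2 - 1) * q by rewrite -/q; lra.
  by have /andP[] := exp_entropy_bounds hb hw (ltr1n R 2) q0 Lq.
(* The number [x] of coverings of a cell is 2bw when the sides differ and the square of [b] when
   they agree. *)
have upper_bound (x : R) : 1 < x -> (size (orientations b w) * (b * w))%:R = x ->
    exp_entropy R b w <= x ^+ (2 * (b * w) + 1) / (x - 1) ^+ (2 * (b * w) - 1).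
  move=> x1 xE.
  have xq : (size (orientations b w) * (b * w))%:R * (x / (x - 1)) ^+ (2 * (b * w)) <=
      (x / (x - 1) - 1) * (x ^+ (2 * (b * w) + 1) / (x - 1) ^+ (2 * (b * w) - 1)).
    by rewrite xE growth_bound_eq ?muln_gt0 ?hb ?hw.
  by have /andP[] :=
    exp_entropy_bounds hb hw (div_subr1_gt1 x1) (growth_bound_gt0 _ x1) xq.
move: lower_bound upper_bound; rewrite /growth /orientations.
have natrB1 (k : nat) : (0 < k)%N -> (k - 1)%:R = k%:R - 1 :> R by move=> ?; rewrite natrB.
split=> [/eqP bw|bw].
  rewrite (negbTE bw) /= in lower_bound upper_bound *.
  have xE : 2 * b%:R * w%:R = (2 * (b * w))%:R :> R by rewrite !natrM mulrA.
  split; last by rewrite xE -!mulnA; apply: upper_bound; rewrite // ltr1n; nia.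
  move: lower_bound.
  by rewrite natrD natrX !natrM !natrB1 ?muln_gt0 ?addn_gt0 ?hb// !natrM natrD.
rewrite -bw eqxx /= in lower_bound upper_bound *.
split.
  move: lower_bound.
  by rewrite addn0 natrM natrB1 ?muln_gt0 ?hb// natrM -expr2.
(* For [b = 1] the number of coverings is 1, outside the range [1 < x], and the claimed bound is
   infinite. *)
case: eqP => [_|/eqP b1]; first exact: leey.
have xE : b%:R ^+ 2 = (b * b)%:R :> R by rewrite natrM.
rewrite lee_fin xE -mulnn; apply: upper_bound; rewrite ?mul1n// ltr1n; nia.
Qed.
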